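(* Let $n\geq 3$, let $\mathcal K\subseteq\mathbb R^n$ be a proper subdual cone and $\mathcal C=\mathbb S^{n-1}\cap\operatorname{int}(\mathcal K)$. Let $A=A^\top\in\mathbb R^{n\times n}$ and let $\{v^1,\dots,v^n\}$ be an orthonormal system of eigenvectors of $A$ corresponding to the eigenvalues $\lambda_1,\dots,\lambda_n$, respectively. Assume that $\lambda:=\lambda_1$, $\mu:=\lambda_2=\dots=\lambda_{n-1}$, $\eta:=\lambda_n$ satisfy $\lambda<\mu<\eta$ and that $$v^1-\sqrt{\frac{\eta-\mu}{\mu-\lambda}}\;|v^n|^{\mathcal K}\in\mathcal K^*.$$ Then the quadratic function $q_A:\mathcal C\to\mathbb R$, $q_A(x)=\langle Ax,x\rangle$, is spherically quasi-convex.
   Context: $\langle\cdot,\cdot\rangle$ and $\|\cdot\|$ are the canonical inner product and norm of $\mathbb R^n$; $\mathbb S^{n-1}=\{x\in\mathbb R^n:\|x\|=1\}$. A cone is a set $\mathcal K\subseteq\mathbb R^n$ with $\alpha x\in\mathcal K$ for all $\alpha>0$, $x\in\mathcal K$. Its dual is $\mathcal K^*=\{x\in\mathbb R^n:\langle x,y\rangle\ge 0\ \forall y\in\mathcal K\}$. A cone is pointed if $\mathcal K\cap(-\mathcal K)\subseteq\{0\}$; proper if it is a pointed closed convex cone with nonempty interior; subdual if $\mathcal K\subseteq\mathcal K^*$. For a closed convex cone $\mathcal K$, $P_{\mathcal K}(x)$ is the Euclidean projection of $x$ onto $\mathcal K$, and for $x\in\mathbb R^n$ the absolute value of $x$ with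 respect to $\mathcal K$ is $|x|^{\mathcal K}:=P_{\mathcal K}(x)+P_{\mathcal K^*}(-x)$. The intrinsic distance on the sphere is $d(x,y)=\arccos\langle x,y\rangle$; a geodesic is the intersection of the sphere with a plane through the origin, and a geodesic segment joining $x$ to $y$ is minimal if its length is $d(x,y)$. A set $\mathcal C\subseteq\mathbb S^{n-1}$ is spherically convex if it contains all minimal geodesic segments joining any two of its points (the set $\mathcal C=\mathbb S^{n-1}\cap\operatorname{int}(\mathcal K)$ is spherically convex). A function $f:\mathcal C\to\mathbb R$ on a spherically convex set is spherically quasi-convex if for every minimal geodesic segment $\gamma:I\to\mathcal C$ ($I\subseteq\mathbb R$ an interval), $f(\gamma(t))\le\max\{f(\gamma(t_1)),f(\gamma(t_2))\}$ for all $t\in[t_1,t_2]\subseteq I$. *)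

(* Defs.v *)
From HB Require Import structures.
From mathcomp Require Import all_boot all_order all_algebra.
From mathcomp Require Import all_classical all_reals all_analysis.

Set Implicit Arguments.
Unset Strict Implicit.
Unset Printing Implicit Defensive.

Import Order.TTheory GRing.Theory Num.Theory.
Import numFieldNormedType.Exports.

Local Open Scope classical_set_scope.
Local Open Scope ring_scope.

(* R^n is 'cV[R]_n.  The norm `|x| that the library puts on matrices is the
   max norm, hence the explicit inner product and Euclidean norm below; the
   topology is the same, so [closed], [interior] and [continuous] are the
   library's. *)

Definition dot (R : realType) (n : nat) (x y : 'cV[R]_n) : R :=
  \sum_(i < n) x i 0 * y i 0.

Definition enorm (R : realType) (n : nat) (x : 'cV[R]_n) : R :=
  Num.sqrt (dot x x).

Definition sphere (R : realType) (n : nat) : set 'cV[R]_n :=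
  [set x | enorm x = 1].

Definition is_cone (R : realType) (n : nat) (K : set 'cV[R]_n) : Prop :=
  forall (a : R) (x : 'cV[R]_n), 0 < a -> K x -> K (a *: x).

Definition dual_cone (R : realType) (n : nat) (K : set 'cV[R]_n) :
    set 'cV[R]_n :=
  [set x | forall y, K y -> 0 <= dot x y].

Definition pointed_cone (R : realType) (n : nat) (K : set 'cV[R]_n) : Prop :=
  K `&` [set x | K (- x)] `<=` [set 0].

Definition proper_cone (R : realType) (n : nat) (K : set 'cV[R]_n) : Prop :=
  [/\ is_cone K, pointed_cone K, closed K,
      convex_set (K : set (convex_lmodType 'cV[R]_n)) & interior K !=set0].

Definition subdual (R : realType) (n : nat) (K : set 'cV[R]_n) : Prop :=
  K `<=` dual_cone K.

(* The nearest point of K to x; the default 0 of [xget] is irrelevant when K is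
   a nonempty closed convex set, where the nearest point exists and is unique. *)
Definition proj (R : realType) (n : nat) (K : set 'cV[R]_n) (x : 'cV[R]_n) :
    'cV[R]_n :=
  xget 0 [set p | K p /\ forall y, K y -> enorm (x - p) <= enorm (x - y)].

Definition cone_abs (R : realType) (n : nat) (K : set 'cV[R]_n)
    (x : 'cV[R]_n) : 'cV[R]_n :=
  proj K x + proj (dual_cone K) (- x).

Definition sdist (R : realType) (n : nat) (x y : 'cV[R]_n) : R :=
  acos (dot x y).

Definition is_geodesic (R : realType) (n : nat) (G : set 'cV[R]_n) : Prop :=
  exists P : {vspace 'cV[R]_n},
    (\dim P = 2)%N /\ G = @sphere R n `&` [set x | x \in P].

(* Arc length of g on [a, b]: the supremum of the Euclidean lengths of the
   inscribed polygons ([a :: s] runs over the subdivisions of [a, b]). *)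
Definition curve_length (R : realType) (n : nat) (a b : R)
    (g : R -> 'cV[R]_n) : \bar R :=
  ereal_sup
    [set (\sum_(0 <= k < size s)
            enorm (g (nth b (a :: s) k.+1) - g (nth b (a :: s) k)))%:E
    | s in itv_partition a b].

(* The parametrization g need not have constant speed. *)
Definition minimal_geodesic_segment (R : realType) (n : nat) (a b : R)
    (g : R -> 'cV[R]_n) : Prop :=
  [/\ a <= b,
      {within `[a, b], continuous g},
      exists2 G : set 'cV[R]_n, is_geodesic G & g @` `[a, b] `<=` G
    & curve_length a b g = (sdist (g a) (g b))%:E].

Definition spherically_convex (R : realType) (n : nat) (C : set 'cV[R]_n) :
    Prop :=
  C `<=` @sphere R n /\
  forall (a b : R) (g : R -> 'cV[R]_n),
    minimal_geodesic_segment a b g -> C (g a) -> C (g b) ->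
    g @` `[a, b] `<=` C.

(* A function on C is represented by a total function, of which only the values
   on C matter.  Segments are parametrized by compact intervals [a, b]; a
   parametrization by any other interval I is covered by its restrictions to the
   compact subintervals of I, as the inequality only involves [t1, t2]. *)
Definition spherically_quasi_convex (R : realType) (n : nat)
    (C : set 'cV[R]_n) (f : 'cV[R]_n -> R) : Prop :=
  spherically_convex C /\
  forall (a b : R) (g : R -> 'cV[R]_n),
    minimal_geodesic_segment a b g -> g @` `[a, b] `<=` C ->
    forall t1 t2 t : R, a <= t1 -> t1 <= t -> t <= t2 -> t2 <= b ->
      f (g t) <= Num.max (f (g t1)) (f (g t2)).

Definition quad (R : realType) (n : nat) (A : 'M[R]_n) (x : 'cV[R]_n) : R :=
  dot (A *m x) x.

(* Main.v *)
Require Import Defs.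
From HB Require Import structures.
From mathcomp Require Import all_boot all_order all_algebra.
From mathcomp Require Import all_classical all_reals all_analysis.
From mathcomp Require Import ring lra.

Import Order.TTheory GRing.Theory Num.Theory.
Import numFieldNormedType.Exports.

Local Open Scope classical_set_scope.
Local Open Scope ring_scope.

(** The proof has a metric half and an algebraic half.

    Metric half. A minimal geodesic segment is given only as a continuous curve
    on the sphere whose length is the distance of its end points. Spherical
    distance satisfies the triangle inequality ([sdist_triangle]), and short
    chords are almost as long as the arcs they cut off ([sdist_le_chord]); so
    every stretch of the curve carries an inscribed polygon of length nearly the
    distance of its ends ([inscribed_polygon]), and the distances along a
    minimal segment add up ([minimal_segment_additive]). In a subdual cone no
    two unit vectors are antipodal, and then additivity of the distances forces the
    middle point to be a combination of the outer ones with nonnegative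
    coefficients ([minimal_segment_between]). The interior of the cone absorbs
    such combinations, hence the convexity of the domain.

    Algebraic half. By Moreau's decomposition
    $|\langle v^n, x\rangle| \le \langle |v^n|^{\mathcal K}, x\rangle$ on
    the cone ([dot_le_cone_abs]), so the hypothesis on the dual cone says that
    $\langle v^1, x\rangle \ge
    \sqrt{(\eta-\mu)/(\mu-\lambda)}\, |\langle v^n, x\rangle|$ there,
    and therefore $q_A \le \mu$ on the domain ([quad_le_middle]). The larger
    value $m$ of $q_A$ at two points of the domain thus lies in
    $[\lambda, \mu]$. For such $m$ the form of $A - m$ has at most one negative
    direction $v^1$, and both points lie in the half of its nonpositive cone
    where the coordinate on $v^1$ is nonnegative. That half is a second-order
    cone, so it is convex ([quad_sublevel_mixed]), and every point of the
    segment between the two has $q_A \le m$. *)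

(** * Inner product and Cauchy-Schwarz *)

Lemma dotE {R : realType} {n : nat} (x y : 'cV[R]_n) :
  dot x y = (x^T *m y) 0 0.
Proof. by rewrite mxE; apply: eq_bigr => i _; rewrite mxE. Qed.

Lemma dotC {R : realType} {n : nat} (x y : 'cV[R]_n) : dot x y = dot y x.
Proof. by apply: eq_bigr => i _; rewrite mulrC. Qed.

Lemma dotDl {R : realType} {n : nat} (x y z : 'cV[R]_n) :
  dot (x + y) z = dot x z + dot y z.
Proof. by rewrite -big_split; apply: eq_bigr => i _; rewrite mxE mulrDl. Qed.

Lemma dotZl {R : realType} {n : nat} (a : R) (x y : 'cV[R]_n) :
  dot (a *: x) y = a * dot x y.
Proof. by rewrite mulr_sumr; apply: eq_bigr => i _; rewrite mxE mulrA. Qed.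

Lemma dotNl {R : realType} {n : nat} (x y : 'cV[R]_n) :
  dot (- x) y = - dot x y.
Proof. by rewrite -scaleN1r dotZl mulN1r. Qed.

Lemma dotDr {R : realType} {n : nat} (x y z : 'cV[R]_n) :
  dot z (x + y) = dot z x + dot z y.
Proof. by rewrite dotC dotDl !(dotC z). Qed.

Lemma dotZr {R : realType} {n : nat} (a : R) (x y : 'cV[R]_n) :
  dot y (a *: x) = a * dot y x.
Proof. by rewrite dotC dotZl (dotC y). Qed.

Lemma dotNr {R : realType} {n : nat} (x y : 'cV[R]_n) :
  dot y (- x) = - dot y x.
Proof. by rewrite dotC dotNl (dotC y). Qed.

Definition dot_lin := (@dotDl, @dotDr, @dotNl, @dotNr, @dotZl, @dotZr).

Lemma dot_ge0 {R : realType} {n : nat} (x : 'cV[R]_n) : 0 <= dot x x.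
Proof. by apply: sumr_ge0 => i _; rewrite -expr2 sqr_ge0. Qed.

Lemma dot_eq0 {R : realType} {n : nat} (x : 'cV[R]_n) : dot x x = 0 -> x = 0.
Proof.
move=> /eqP; rewrite psumr_eq0 => [/allP x0|i _]; last by rewrite -expr2 sqr_ge0.
apply/colP => i; rewrite mxE; apply/eqP.
by have := x0 i (mem_index_enum i); rewrite /= mulf_eq0 orbb.
Qed.

Lemma enorm_ge0 {R : realType} {n : nat} (x : 'cV[R]_n) : 0 <= enorm x.
Proof. exact: sqrtr_ge0. Qed.

Lemma sqr_enorm {R : realType} {n : nat} (x : 'cV[R]_n) :
  enorm x ^+ 2 = dot x x.
Proof. by rewrite sqr_sqrtr ?dot_ge0. Qed.

Lemma ler_enorm {R : realType} {n : nat} (x y : 'cV[R]_n) :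
  (enorm x <= enorm y) = (dot x x <= dot y y).
Proof. by rewrite -!sqr_enorm ler_pXn2r ?nnegrE ?enorm_ge0. Qed.

Lemma sphere_dot {R : realType} {n : nat} (x : 'cV[R]_n) :
  @sphere R n x -> dot x x = 1.
Proof. by rewrite /sphere /= -sqr_enorm => ->; rewrite expr1n. Qed.

(** Lagrange's identity: the double sum of the terms
    $w_i w_j (x_i y_j - x_j y_i)^2$ is twice the difference of the sides.
    Weights that may vanish are what makes the inequality apply to a form that
    is only positive semidefinite. *)
Lemma weighted_cauchy_schwarz {R : realType} {n : nat} (w x y : 'I_n -> R) :
  (forall i, 0 <= w i) ->
  (\sum_i w i * x i * y i) ^+ 2
  <= (\sum_i w i * x i ^+ 2) * (\sum_i w i * y i ^+ 2).
Proof.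
move=> w0.
have : 0 <= \sum_i \sum_j w i * w j * (x i * y j - x j * y i) ^+ 2.
  by do 2!apply: sumr_ge0 => ? _; rewrite mulr_ge0 ?sqr_ge0 ?mulr_ge0.
rewrite (_ : \sum_i _ = (\sum_i w i * x i ^+ 2) * (\sum_i w i * y i ^+ 2)
   + (\sum_i w i * y i ^+ 2) * (\sum_i w i * x i ^+ 2)
   - 2 * ((\sum_i w i * x i * y i) * (\sum_i w i * x i * y i))).
  by nra.
rewrite !big_distrlr /= mulr_sumr -sumrN -!big_split /=; apply: eq_bigr => i _.
rewrite mulr_sumr -sumrN -!big_split /=; apply: eq_bigr => j _; ring.
Qed.

Lemma cauchy_schwarz {R : realType} {n : nat} (x y : 'cV[R]_n) :
  dot x y ^+ 2 <= dot x x * dot y y.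
Proof.
have := @weighted_cauchy_schwarz R n (fun=> 1) (x ^~ 0) (y ^~ 0) (fun=> ler01).
rewrite /= /dot; under eq_bigr do rewrite mul1r.
under [in X in _ <= X * _]eq_bigr do rewrite mul1r expr2.
by under [in X in _ <= _ * X]eq_bigr do rewrite mul1r expr2.
Qed.

Lemma sphere_dot_bound {R : realType} {n : nat} (x y : 'cV[R]_n) :
  @sphere R n x -> @sphere R n y -> -1 <= dot x y <= 1.
Proof.
move=> /sphere_dot xx /sphere_dot yy.
have := cauchy_schwarz x y; rewrite xx yy => h.
by apply/andP; split; nra.
Qed.

(** * Spherical distance *)

Lemma cos_sdist {R : realType} {n : nat} (x y : 'cV[R]_n) :
  @sphere R n x -> @sphere R n y -> cos (sdist x y) = dot x y.
Proof. by move=> hx hy; have [] := acos_def (sphere_dot_bound _ _ hx hy). Qed.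

Lemma sdist_bound {R : realType} {n : nat} (x y : 'cV[R]_n) :
  @sphere R n x -> @sphere R n y -> 0 <= sdist x y <= pi.
Proof. by move=> hx hy; have [] := acos_def (sphere_dot_bound _ _ hx hy). Qed.

Lemma sdistxx {R : realType} {n : nat} (x : 'cV[R]_n) :
  @sphere R n x -> sdist x x = 0.
Proof. by move=> /sphere_dot xx; rewrite /sdist xx acos1. Qed.

Lemma ler_cos {R : realType} (s t : R) :
  0 <= s <= pi -> 0 <= t <= pi -> (cos s <= cos t) = (t <= s).
Proof. by move=> hs ht; rewrite !leNgt ltr_cos. Qed.

Lemma sqr_enormB_sphere {R : realType} {n : nat} (x y : 'cV[R]_n) :
  @sphere R n x -> @sphere R n y -> enorm (x - y) ^+ 2 = 2 - 2 * dot x y.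
Proof.
move=> /sphere_dot xx /sphere_dot yy.
by rewrite sqr_enorm !dot_lin xx yy (dotC y x); ring.
Qed.

Lemma sdist_triangle {R : realType} {n : nat} (x y z : 'cV[R]_n) :
  @sphere R n x -> @sphere R n y -> @sphere R n z ->
  sdist x z <= sdist x y + sdist y z.
Proof.
move=> hx hy hz.
have /andP[a0 api] := sdist_bound _ _ hx hy.
have /andP[b0 bpi] := sdist_bound _ _ hy hz.
have /andP[c0 cpi] := sdist_bound _ _ hx hz.
have [h|h] := leP pi (sdist x y + sdist y z); first exact: le_trans h.
rewrite -ler_cos ?c0 ?cpi ?addr_ge0 ?(ltW h)//.
rewrite cosD !cos_sdist//.
have sa : 0 <= sin (sdist x y) by rewrite sin_ge0_pi ?a0.
have sb : 0 <= sin (sdist y z) by rewrite sin_ge0_pi ?b0.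
have sa2 := sin2cos2 (sdist x y); have sb2 := sin2cos2 (sdist y z).
rewrite !cos_sdist// in sa2 sb2.
(* Cauchy-Schwarz for the components of x and z orthogonal to y, whose norms
   are the sines of the two distances *)
have := cauchy_schwarz (x - dot x y *: y) (z - dot y z *: y).
rewrite !dot_lin (sphere_dot _ hx) (sphere_dot _ hy) (sphere_dot _ hz).
rewrite (dotC y x) (dotC z y) => cs.
have {}cs : (dot x z - dot x y * dot y z) ^+ 2
     <= (sin (sdist x y) * sin (sdist y z)) ^+ 2.
  rewrite exprMn sa2 sb2; move: cs; congr (_ <= _); ring.
have s0 := mulr_ge0 sa sb.
have := ler_norm (dot x y * dot y z - dot x z).
rewrite distrC; move: cs; rewrite -ler_sqrt ?sqr_ge0// !sqrtr_sqr (ger0_norm s0).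
lra.
Qed.
Lemma mul_cos_le_sin {R : realType} (t : R) :
  0 <= t <= pi / 2 -> t * cos t <= sin t.
Proof.
move=> /andP[t0 tpi].
have pi0 := @pi_gt0 R.
have [c|c] := @MVT_segment R sin cos 0 t t0 (fun x _ => is_derive_sin x).
  exact/continuous_subspaceT/continuous_sin.
rewrite in_itv/= => /andP[c0 ct]; rewrite sin0 !subr0 => ->.
rewrite mulrC ler_wpM2r// ler_cos ?c0 ?t0//=; lra.
Qed.

(** Writing $t$ for half the angle, the chord is $2 \sin t$ and the factor is
    $\cos^2 t$, so this is $t \cos^2 t \le t \cos t \le \sin t$. *)
Lemma sdist_le_chord {R : realType} {n : nat} (x y : 'cV[R]_n) :
  @sphere R n x -> @sphere R n y ->
  sdist x y * ((1 + dot x y) / 2) <= enorm (x - y).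
Proof.
move=> hx hy; have /andP[d0 dpi] := sdist_bound _ _ hx hy.
pose t := sdist x y / 2.
have dE : sdist x y = t *+ 2 by rewrite /t; lra.
have t0 : 0 <= t by rewrite /t; lra.
have tpi : t <= pi / 2 by rewrite /t; lra.
have pi0 := @pi_gt0 R.
have c0 : 0 <= cos t by apply: cos_ge0_pihalf; rewrite tpi andbT; lra.
have s0 : 0 <= sin t by apply: sin_ge0_pi; rewrite t0 /=; lra.
have c1 := cos_le1 t; have cs := cos2Dsin2 t.
have dotE' : dot x y = cos t ^+ 2 *+ 2 - 1 by rewrite -cos_sdist// dE cos_mulr2n.
have -> : enorm (x - y) = 2 * sin t.
  have : enorm (x - y) ^+ 2 = (2 * sin t) ^+ 2.
    by rewrite sqr_enormB_sphere// dotE' exprMn; lra.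
  move=> /eqP; rewrite eqrXn2 ?enorm_ge0 ?mulr_ge0// => /eqP //.
have := mul_cos_le_sin t; rewrite t0 tpi => /(_ isT) h.
have -> : (1 + dot x y) / 2 = cos t ^+ 2 by rewrite dotE'; lra.
rewrite dE; apply: (@le_trans _ _ (2 * (t * cos t))); last by lra.
have : t * cos t * cos t <= t * cos t by rewrite ler_piMr// mulr_ge0.
by rewrite expr2; lra.
Qed.

(** Equality in the triangle inequality: with $\theta = \alpha + \beta$ the sum
    of the distances $\alpha$ from $x$ to $y$ and $\beta$ from $y$ to $z$, the
    vector $\sin\theta\, y - \sin\beta\, x - \sin\alpha\, z$ has norm zero. *)
Lemma sdist_between {R : realType} {n : nat} (x y z : 'cV[R]_n) :
  @sphere R n x -> @sphere R n y -> @sphere R n z ->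
  sdist x z < pi -> sdist x y + sdist y z <= sdist x z ->
  exists a b : R, [/\ 0 <= a, 0 <= b & y = a *: x + b *: z].
Proof.
move=> hx hy hz ltpi le_d.
have /andP[a0 api] := sdist_bound _ _ hx hy.
have /andP[b0 bpi] := sdist_bound _ _ hy hz.
have /andP[c0 cpi] := sdist_bound _ _ hx hz.
have dE : sdist x z = sdist x y + sdist y z.
  by apply/eqP; rewrite eq_le sdist_triangle.
have xx := sphere_dot _ hx; have yy := sphere_dot _ hy; have zz := sphere_dot _ hz.
move: c0; rewrite le_eqVlt => /predU1P[c0|c_gt0].
  exists 1, 0; split => //; rewrite scale1r scale0r addr0.
  apply/eqP; rewrite -subr_eq0; apply/eqP/dot_eq0.
  have : dot x y = 1.
    by rewrite -cos_sdist// (_ : sdist x y = 0) ?cos0//; lra.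
  by rewrite !dot_lin xx yy (dotC y x) => ->; ring.
set al := sdist x y in api a0 le_d dE *; set be := sdist y z in bpi b0 le_d dE *.
have s_gt0 : 0 < sin (sdist x z) by rewrite sin_gt0_pi ?c_gt0.
exists (sin be / sin (sdist x z)), (sin al / sin (sdist x z)).
split; rewrite ?divr_ge0 ?sin_ge0_pi ?a0 ?b0 ?(ltW c_gt0)//.
rewrite !(mulrC _ _^-1) -!scalerA -scalerDr.
apply: (can_inj (scalerK (lt0r_neq0 s_gt0))).
rewrite scalerA mulfV ?gt_eqF// scale1r.
apply/eqP; rewrite -subr_eq0; apply/eqP/dot_eq0.
rewrite !dot_lin xx yy zz (dotC y x) (dotC z y) (dotC z x) -!cos_sdist//.
rewrite -/al -/be dE sinD cosD.
have ha := cos2Dsin2 al; have hb := cos2Dsin2 be.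
have {}ha : cos al ^+ 2 = 1 - sin al ^+ 2 by rewrite -ha; ring.
have {}hb : cos be ^+ 2 = 1 - sin be ^+ 2 by rewrite -hb; ring.
by ring: ha hb.
Qed.

(** * Length of curves on the sphere *)

(** The sum that defines [curve_length], recursive in the subdivision so that
    consecutive subdivisions concatenate. *)
Fixpoint chord_sum {R : realType} {n : nat} (g : R -> 'cV[R]_n) (u : R)
    (s : seq R) : R :=
  if s is w :: s' then enorm (g w - g u) + chord_sum g w s' else 0.

Lemma chord_sumE {R : realType} {n : nat} (g : R -> 'cV[R]_n) (u b : R)
    (s : seq R) :
  \sum_(0 <= k < size s)
    enorm (g (nth b (u :: s) k.+1) - g (nth b (u :: s) k)) = chord_sum g u s.
Proof.
elim: s u => [|w s IHs] u; first by rewrite big_geq.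
by rewrite big_nat_recl//= -IHs.
Qed.

Lemma chord_sum_cat {R : realType} {n : nat} (g : R -> 'cV[R]_n) (u : R)
    (s t : seq R) :
  chord_sum g u (s ++ t) = chord_sum g u s + chord_sum g (last u s) t.
Proof. by elim: s u => [|w s IHs] u /=; rewrite ?add0r// IHs addrA. Qed.

Lemma dot_continuous {R : realType} {n : nat} (y : 'cV[R]_n) :
  continuous (fun x : 'cV[R]_n => dot x y).
Proof.
apply: continuous_big => [|i _ x]; first exact: add_continuous.
apply: (@continuousM _ _ (fun z : ('cV[R]_n) => z i 0) (cst (y i 0))).
  exact: coord_continuous.
exact: cst_continuous.
Qed.

(** By continuity the factor in [sdist_le_chord] exceeds $k$ for any two points of
    the curve one of which is a given $g(m)$ and the other is near it. Hence the
    set of the points up to which a good subdivision exists contains its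
    supremum $m$ (add the chord ending at $m$), and would contain points beyond
    $m$ (add the chord starting at $m$) if $m$ were less than $b$. *)
Lemma inscribed_polygon {R : realType} {n : nat} (a b k : R)
    (g : R -> 'cV[R]_n) :
  a <= b -> {within `[a, b], continuous g} ->
  (forall t, a <= t <= b -> @sphere R n (g t)) -> 0 <= k < 1 ->
  exists2 s, itv_partition a b s & k * sdist (g a) (g b) <= chord_sum g a s.
Proof.
move=> ab cg sg /andP[k0 k1].
pose Q w := exists2 s, itv_partition a w s &
  k * sdist (g a) (g w) <= chord_sum g a s.
have extend u w : a <= u -> u < w -> w <= b ->
    k <= (1 + dot (g u) (g w)) / 2 -> Q u -> Q w.
  move=> au uw wb kuw [s su ds].
  exists (s ++ [:: w]); first exact/(itv_partition_cat su)/itv_partition1.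
  have -> : chord_sum g a (s ++ [:: w]) = chord_sum g a s + enorm (g w - g u).
    by case: su => _ /eqP lu; rewrite chord_sum_cat lu /= addr0.
  have ha : @sphere R n (g a) by apply: sg; rewrite lexx ab.
  have hu : @sphere R n (g u) by apply: sg; rewrite au/= ltW// (lt_le_trans uw).
  have hw : @sphere R n (g w) by apply: sg; rewrite wb andbT ltW// (le_lt_trans au).
  have tri := sdist_triangle _ _ _ ha hu hw.
  have /andP[d0 _] := sdist_bound _ _ hw hu.
  have ch := sdist_le_chord _ _ hw hu.
  have sC : sdist (g u) (g w) = sdist (g w) (g u) by rewrite /sdist dotC.
  have := ler_wpM2l k0 tri; have := ler_wpM2l d0 kuw.
  rewrite (dotC (g u)); rewrite mulrDr sC; lra.
have [aa bb] : a <= a <= b /\ a <= b <= b by rewrite !lexx ab.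
pose A := [set w | a <= w <= b /\ Q w].
have Aa : A a.
  split=> //; exists [::]; first by split.
  by rewrite sdistxx ?mulr0 //; exact: sg.
have ubA : ubound A b by move=> w [/andP[]].
have supA : has_sup A by split; [exists a | exists b].
pose m := sup A.
have am : a <= m by apply: ub_le_sup => //; exists b.
have mb : m <= b by apply: ge_sup => //; exists a.
have [d d0 near_m] : exists2 d, 0 < d & forall w, a <= w <= b -> `|m - w| < d ->
    k <= (1 + dot (g w) (g m)) / 2.
  have hm : @sphere R n (g m) by apply: sg; rewrite am.
  have gm : g @ within `[a, b] (nbhs m) --> g m.
    by move/subspace_continuousP : cg; apply; rewrite /= in_itv/= am.
  have : (fun w => dot (g w) (g m)) @ within `[a, b] (nbhs m) --> (1 : R).
    rewrite -(sphere_dot _ hm).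
    exact: (cvg_comp _ (fun y => dot y (g m)) gm (dot_continuous _ _)).
  move=> /cvgr_gt /(_ (2 * k - 1)); rewrite (_ : _ < 1 = true); last by lra.
  move=> /(_ isT); rewrite /prop_near1 /within/= => /nbhs_ballP[d /= d0 hd].
  exists d => // w abw mw; have := hd w mw; rewrite /= in_itv/= => /(_ abw); lra.
have Qm : Q m.
  have [w [/andP[aw wb] Qw] mw] := sup_adherent d0 supA.
  have : w <= m by apply: ub_le_sup; [exists b | split; rewrite ?aw].
  rewrite le_eqVlt => /predU1P[<-//|wm].
  apply: (extend w) => //; apply: near_m; rewrite ?aw//.
  by rewrite gtr0_norm ?subr_gt0//; move: mw; rewrite -/m; lra.
have [mltb|] := ltP m b; last by move=> bm; rewrite (_ : b = m) //; apply/le_anti/andP.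
(* a point beyond m that a further chord reaches, against the choice of m *)
pose w := Num.min b (m + d / 2).
have mw : m < w by rewrite lt_min mltb ltrDl divr_gt0.
have wb : w <= b by rewrite ge_min lexx.
have wd : w <= m + d / 2 by rewrite ge_min lexx orbT.
have Aw : A w.
  split; first by rewrite wb andbT ltW// (le_lt_trans am).
  apply: (extend m) => //; rewrite dotC; apply: near_m.
    by rewrite wb andbT ltW// (le_lt_trans am).
  by rewrite ltr0_norm ?subr_lt0//; lra.
have : w <= m by apply: ub_le_sup Aw; exists b.
by rewrite leNgt mw.
Qed.

(** The segment from $t_1$ to $t_2$ of a minimal segment is minimal as well:
    polygons inscribed on the four pieces concatenate to one inscribed in the
    whole curve, so the four distances add up to at most its length, and the
    triangle inequality removes the first and the last of them. *)
Lemma minimal_segment_additive {R : realType} {n : nat} (a b : R)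
    (g : R -> 'cV[R]_n) (t1 t t2 : R) :
  minimal_geodesic_segment a b g ->
  a <= t1 -> t1 <= t -> t <= t2 -> t2 <= b ->
  sdist (g t1) (g t) + sdist (g t) (g t2) <= sdist (g t1) (g t2).
Proof.
move=> [ab cg [G [P [_ ->]] gG] len] at1 t1t tt2 t2b.
have sg u : a <= u <= b -> @sphere R n (g u).
  move=> abu; apply: proj1 (gG (g u) _); exists u; first by rewrite /= in_itv.
  by [].
have tb := le_trans tt2 t2b; have t1b := le_trans t1t tb.
have at_ := le_trans at1 t1t; have at2 := le_trans at_ tt2.
have poly (u w k : R) : a <= u -> u <= w -> w <= b -> 0 <= k < 1 ->
    exists2 s, itv_partition u w s & k * sdist (g u) (g w) <= chord_sum g u s.
  move=> au uw wb; apply: inscribed_polygon => //.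
    apply: continuous_subspaceW cg => x /=; rewrite !in_itv/= => /andP[ux xw].
    by rewrite (le_trans au)//= (le_trans xw).
  by move=> x /andP[ux xw]; apply: sg; rewrite (le_trans au)//= (le_trans xw).
have sum_le : sdist (g a) (g t1) + sdist (g t1) (g t) + sdist (g t) (g t2)
    + sdist (g t2) (g b) <= sdist (g a) (g b).
  set D := (X in X <= _).
  have scaled (k : R) : 0 <= k < 1 -> k * D <= sdist (g a) (g b).
    move=> k01.
    have [s1 p1 l1] := poly a t1 k (lexx _) at1 t1b k01.
    have [s2 p2 l2] := poly t1 t k at1 t1t tb k01.
    have [s3 p3 l3] := poly t t2 k at_ tt2 t2b k01.
    have [s4 p4 l4] := poly t2 b k at2 t2b (lexx _) k01.
    have p := itv_partition_cat p1 (itv_partition_cat p2 (itv_partition_cat p3 p4)).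
    have : ((chord_sum g a (s1 ++ s2 ++ s3 ++ s4))%:E <= (sdist (g a) (g b))%:E)%E.
      rewrite -len; apply: ereal_sup_ubound; exists (s1 ++ s2 ++ s3 ++ s4) => //.
      by rewrite chord_sumE.
    rewrite lee_fin; move: p1 p2 p3 => [_ /eqP e1] [_ /eqP e2] [_ /eqP e3].
    rewrite !chord_sum_cat e1 e2 e3 /D; lra.
  have ha : @sphere R n (g a) by apply: sg; rewrite lexx.
  have hb : @sphere R n (g b) by apply: sg; rewrite lexx andbT.
  have /andP[d0 _] := sdist_bound _ _ ha hb.
  clearbody D; rewrite leNgt; apply/negP => dD.
  have D0 : 0 < D by apply: le_lt_trans dD.
  (* this factor scales D to the midpoint of D and the distance of the ends *)
  have := scaled ((D + sdist (g a) (g b)) / (2 * D)).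
  have -> : (D + sdist (g a) (g b)) / (2 * D) * D = (D + sdist (g a) (g b)) / 2.
    by field; rewrite gt_eqF.
  have -> : 0 <= (D + sdist (g a) (g b)) / (2 * D) < 1.
    rewrite ltr_pdivrMr ?mulr_gt0// divr_ge0 ?addr_ge0 ?mulr_ge0 ?(ltW D0)//=.
    by lra.
  by move=> /(_ isT); lra.
have ha : @sphere R n (g a) by apply: sg; rewrite lexx.
have h1 : @sphere R n (g t1) by apply: sg; rewrite at1.
have h2 : @sphere R n (g t2) by apply: sg; rewrite t2b at2.
have hb : @sphere R n (g b) by apply: sg; rewrite lexx andbT.
have := sdist_triangle _ _ _ ha h1 hb; have := sdist_triangle _ _ _ h1 h2 hb.
by move: sum_le; lra.
Qed.
(** * Convex cones and Moreau's decomposition *)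

(** The sum is twice the midpoint. *)
Lemma cone_add {R : realType} {n : nat} (K : set 'cV[R]_n) (x y : 'cV[R]_n) :
  is_cone K -> convex_set (K : set (convex_lmodType 'cV[R]_n)) ->
  K x -> K y -> K (x + y).
Proof.
move=> coneK convK Kx Ky.
have h0 : (0 : R) <= 2^-1 by rewrite invr_ge0.
have h1 : (2^-1 : R) <= 1 by rewrite invf_le1 // ler1n.
have := convK x y (Itv01 h0 h1); rewrite !inE => /(_ Kx Ky) /(coneK 2 _ (ltr0n R 2)).
rewrite -[X in K X -> _]/(2 *: (2^-1 *: x + (1 - 2^-1) *: y)).
have -> : 1 - 2^-1 = 2^-1 :> R by lra.
by rewrite -scalerDr scalerA mulfV ?scale1r// pnatr_eq0.
Qed.

Lemma interior_cone_scale {R : realType} {n : nat} (K : set 'cV[R]_n.+1)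
    (a : R) (x : 'cV[R]_n.+1) :
  is_cone K -> 0 < a -> interior K x -> interior K (a *: x).
Proof.
move=> coneK a0 Kx.
have : (fun y : 'cV[R]_n.+1 => a^-1 *: y) @ (a *: x) --> a^-1 *: (a *: x).
  exact: (@scaler_continuous R _ a^-1 (a *: x)).
rewrite scalerA mulVf ?gt_eqF// scale1r => /(_ K Kx).
apply: (@filterS _ _ (nbhs_filter (a *: x))) => y /= /(coneK a _ a0).
by rewrite scalerA mulfV ?gt_eqF// scale1r.
Qed.

Lemma interior_cone_add {R : realType} {n : nat} (K : set 'cV[R]_n.+1)
    (x y : 'cV[R]_n.+1) :
  is_cone K -> convex_set (K : set (convex_lmodType 'cV[R]_n.+1)) ->
  interior K x -> K y -> interior K (x + y).
Proof.
move=> coneK convK Kx Ky.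
have : (fun z : 'cV[R]_n.+1 => z - y) @ (x + y) --> (x + y) - y.
  pose V := 'cV[R]_n.+1.
  have := @continuousB R V V (fun z => z) (fun=> y) (x + y).
  by apply; [exact: cvg_id | exact: cst_continuous].
rewrite addrK => /(_ K Kx); apply: (@filterS _ _ (nbhs_filter (x + y))) => z /= Kz.
by rewrite -(subrK y z); exact: cone_add.
Qed.

(** The points of $K$ no farther from $x$ than some given point of $K$ form a
    compact set. They are taken as transposed rows, to lie in a product of
    segments. *)
Lemma nearest_point_exists {R : realType} {n : nat} (K : set 'cV[R]_n)
    (x : 'cV[R]_n) :
  closed K -> K !=set0 ->
  exists2 p, K p & forall y, K y -> enorm (x - p) <= enorm (x - y).
Proof.
move=> clK [z Kz].
pose f (r : 'rV[R]_n) := dot (x - r^T) (x - r^T).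
have tr_cont : continuous (fun r : 'rV[R]_n => r^T).
  move=> r s /= /(nbhs_ballP r^T) [e e0 es].
  apply/nbhs_ballP; exists e => //= t [_ rt]; apply: es.
  by split=> // i j; rewrite !mxE; exact: rt.
have f_cont : continuous f.
  apply: continuous_big => [|i _ r]; first exact: add_continuous.
  have ci : {for r, continuous (fun r : 'rV[R]_n => (x - r^T) i 0)}.
    have -> : (fun s : 'rV[R]_n => (x - s^T) i 0) = (fun s => x i 0 - s 0 i).
      by apply/funext => s; rewrite !mxE.
    apply: (@continuousB _ _ _ (cst (x i 0)) (fun s : 'rV[R]_n => s 0 i)).
      exact: cst_continuous.
    exact: coord_continuous.
  exact: continuousM.
pose B := [set r : 'rV[R]_n | K r^T /\ f r <= f z^T].
have clB : closed B.
  apply: closedI; first exact: preimage_closed.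
  by apply: (preimage_closed (f := f) (D := [set t | t <= f z^T])) => //; exact: closed_le.
(* f is a squared distance; adding 1 makes M a bound on its square root *)
pose M := f z^T + 1.
have cB : compact B.
  apply: subclosed_compact clB (@rV_compact R n (fun i => `[x i 0 - M, x i 0 + M]%classic) _) _.
    by move=> i; exact: segment_compact.
  move=> r [_ fr] i /=; rewrite in_itv/=.
  have : (x i 0 - r 0 i) ^+ 2 <= f r.
    rewrite /f /dot (bigD1 i)//= !mxE expr2 lerDl.
    by apply: sumr_ge0 => j _; rewrite -expr2 sqr_ge0.
  have f0 : 0 <= f z^T by exact: dot_ge0.
  have -> : r ord0 i = r 0 i by [].
  rewrite /M => h; apply/andP; split; nra.
have [||p] := @compact_EVT_min _ R f B _ cB.
- by exists z^T; rewrite /B /= trmxK.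
- exact: continuous_subspaceT.
rewrite inE => -[Kp fp] minp; exists p^T => // y Ky.
rewrite ler_enorm; have [fy|fy] := leP (f y^T) (f z^T).
  have := minp y^T; rewrite inE /B /= trmxK => /(_ (conj Ky fy)).
  by rewrite /f trmxK.
by move: fp fy; rewrite /f !trmxK => fp /ltW; exact: le_trans.
Qed.

(** First-order optimality along a ray: the linear term cannot be positive if it
    is dominated by the quadratic one for all small $t$. *)
Lemma le0_of_le_scaled {R : realType} (a b : R) :
  0 <= b -> (forall t, 0 < t < 1 -> a <= t * b) -> a <= 0.
Proof.
move=> b0 h; rewrite leNgt; apply/negP => a0.
have c0 : 0 < a + b + 1 by lra.
have := h (a / (a + b + 1)); rewrite divr_gt0// ltr_pdivrMr// mul1r.
have -> : a < a + b + 1 by lra.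
move=> /(_ isT); rewrite mulrAC ler_pdivlMr//; nra.
Qed.

(** Optimality of $p$ against the points $p + t y$ of the cone gives membership in
    the dual cone, and against $(1 - t) p$ the orthogonality. *)
Lemma nearest_point_dual {R : realType} {n : nat} (K : set 'cV[R]_n)
    (x p : 'cV[R]_n) :
  is_cone K -> convex_set (K : set (convex_lmodType 'cV[R]_n)) ->
  K p -> (forall y, K y -> enorm (x - p) <= enorm (x - y)) ->
  dual_cone K (p - x) /\ dot (p - x) p = 0.
Proof.
move=> coneK convK Kp minp.
have xE : x = p - (p - x) by rewrite opprB addrC subrK.
move: (p - x) xE => w xE; rewrite {}xE {x} in minp *.
have dualw : dual_cone K w.
  move=> y Ky; rewrite -oppr_le0 -(pmulr_rle0 _ (ltr0n R 2)).
  apply: (le0_of_le_scaled _ (dot y y)); first exact: dot_ge0.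
  move=> t /andP[t0 t1].
  have := minp (p + t *: y) (cone_add _ _ _ coneK convK Kp (coneK _ _ t0 Ky)).
  rewrite ler_enorm !dot_lin (dotC w p) (dotC y p) (dotC y w); nra.
split=> //; apply/le_anti; rewrite dualw// andbT.
rewrite -(pmulr_rle0 _ (ltr0n R 2)).
apply: (le0_of_le_scaled _ (dot p p)); first exact: dot_ge0.
move=> t /andP[t0 t1].
have t1' : 0 < 1 - t by rewrite subr_gt0.
have := minp ((1 - t) *: p) (coneK _ _ t1' Kp).
rewrite ler_enorm !dot_lin (dotC w p); nra.
Qed.

(** Moreau's decomposition: if $p$ is a nearest point of $K$ to $x$, then
    $p - x$ is in the dual cone and orthogonal to $p$, which makes it the unique
    nearest point of the dual cone to $-x$. *)
Lemma moreau {R : realType} {n : nat} (K : set 'cV[R]_n) (x : 'cV[R]_n) :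
  is_cone K -> convex_set (K : set (convex_lmodType 'cV[R]_n)) ->
  closed K -> K !=set0 ->
  [/\ K (Defs.proj K x), dual_cone K (Defs.proj (dual_cone K) (- x))
    & x = Defs.proj K x - Defs.proj (dual_cone K) (- x)].
Proof.
move=> coneK convK clK K0.
have [Kp minp] : K (Defs.proj K x) /\
    forall y, K y -> enorm (x - Defs.proj K x) <= enorm (x - y).
  have [p Kp minp] := nearest_point_exists K x clK K0.
  rewrite /Defs.proj; case: xgetP => [q _ //|none].
  by have := none p; rewrite /= => /(_ (conj Kp minp)).
have [dualw wp] := nearest_point_dual _ _ _ coneK convK Kp minp.
set p := Defs.proj K x in Kp minp dualw wp *.
(* as w = p - x is orthogonal to p, the squared distance from y to -x is
   |w - y|^2 + |p|^2 plus a term that is nonnegative on the dual cone *)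
have dist y : dot (- x - y) (- x - y)
    = dot (p - x - y) (p - x - y) + dot p p + 2 * dot y p.
  have -> : - x - y = (p - x - y) - p.
    by apply/colP => i; rewrite !mxE; ring.
  move: (p - x) wp => w wp.
  rewrite !dot_lin wp (dotC p w) wp (dotC p y) ; ring.
have -> : Defs.proj (dual_cone K) (- x) = p - x.
  rewrite /Defs.proj; case: xgetP => [q _ [dualq minq]|none].
    have := minq _ dualw; rewrite ler_enorm !dist subrr.
    have := dualq _ Kp; have := dot_ge0 (p - x - q); rewrite wp.
    have -> : dot (0 : 'cV[R]_n) 0 = 0 by rewrite -(scale0r 0) dotZl mul0r.
    move=> h1 h2 h3; apply/eqP; rewrite eq_sym -subr_eq0; apply/eqP/dot_eq0; lra.
  exfalso; apply: (none (p - x)); split=> // y dualy.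
  rewrite ler_enorm !dist subrr wp.
  have := dualy _ Kp; have := dot_ge0 (p - x - y).
  have -> : dot (0 : 'cV[R]_n) 0 = 0 by rewrite -(scale0r 0) dotZl mul0r.
  lra.
by split=> //; rewrite opprB addrC subrK.
Qed.

(** Both parts of the decomposition have nonnegative inner products with $x$,
    the one in $K$ because $K$ is subdual; their difference is therefore
    bounded by their sum. *)
Lemma dot_le_cone_abs {R : realType} {n : nat} (K : set 'cV[R]_n)
    (v x : 'cV[R]_n) :
  is_cone K -> convex_set (K : set (convex_lmodType 'cV[R]_n)) ->
  closed K -> subdual K -> K x ->
  `|dot v x| <= dot (cone_abs K v) x.
Proof.
move=> coneK convK clK sub Kx.
have [|Kp dualw vE] := moreau K v coneK convK clK; first by exists x.
rewrite /cone_abs dotDl {1}vE !dot_lin.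
have := sub _ Kp _ Kx; have := dualw _ Kx => h1 h2.
by rewrite (le_trans (ler_normB _ _))// !ger0_norm.
Qed.

(** * The quadratic form in an eigenbasis *)

Lemma dot_orthonormal {R : realType} {n : nat} (v : 'I_n -> 'cV[R]_n)
    (x y : 'cV[R]_n) :
  (forall i j, dot (v i) (v j) = (i == j)%:R) ->
  dot x y = \sum_i dot (v i) x * dot (v i) y.
Proof.
move=> hv; pose V := \matrix_(i, j) v i j 0.
have VVT : V *m V^T = 1%:M.
  apply/matrixP => i j; rewrite !mxE -hv.
  by apply: eq_bigr => k _; rewrite !mxE.
have VE z i : (V *m z) i 0 = dot (v i) z.
  by rewrite mxE; apply: eq_bigr => k _; rewrite mxE.
rewrite dotE -[y in LHS]mul1mx -(mulmx1C VVT) -!mulmxA mulmxA -trmx_mul -dotE.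
by apply: eq_bigr => i _; rewrite !VE.
Qed.

Lemma dot_mulmx_eigen {R : realType} {n : nat} (A : 'M[R]_n)
    (v : 'I_n -> 'cV[R]_n) (lam : 'I_n -> R) (x y : 'cV[R]_n) :
  A = A^T -> (forall i j, dot (v i) (v j) = (i == j)%:R) ->
  (forall i, A *m v i = lam i *: v i) ->
  dot (A *m x) y = \sum_i lam i * dot (v i) x * dot (v i) y.
Proof.
move=> hA hv heig; rewrite (dot_orthonormal v (A *m x) y hv).
apply: eq_bigr => i _; congr (_ * _).
by rewrite dotE mulmxA hA -trmx_mul heig -dotE dotZl.
Qed.

(** If $\lambda_0 \le c \le \lambda_i$ for $i \ne 0$, the form of $A - c$ has at
    most one negative direction, so the part of its nonpositive cone with
    nonnegative coordinates on $v_0$ is a second-order cone; for two points of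
    this cone Cauchy-Schwarz on the remaining coordinates bounds the mixed term. *)
Lemma quad_sublevel_mixed {R : realType} {n : nat} (A : 'M[R]_n.+1)
    (v : 'I_n.+1 -> 'cV[R]_n.+1) (lam : 'I_n.+1 -> R) (c : R)
    (x y : 'cV[R]_n.+1) :
  A = A^T -> (forall i j, dot (v i) (v j) = (i == j)%:R) ->
  (forall i, A *m v i = lam i *: v i) ->
  lam ord0 <= c -> (forall i, i != ord0 -> c <= lam i) ->
  0 <= dot (v ord0) x -> 0 <= dot (v ord0) y ->
  quad A x <= c * dot x x -> quad A y <= c * dot y y ->
  dot (A *m x) y <= c * dot x y.
Proof.
move=> hA hv heig lam0 lami x0 y0.
(* the eigenvalues of A - c, with the nonpositive one deleted *)
pose w i := if i == ord0 then 0 else lam i - c.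
have w0 i : 0 <= w i.
  by rewrite /w; case: eqVneq => // i0; rewrite subr_ge0 lami.
pose N x y := \sum_i w i * dot (v i) x * dot (v i) y.
have NE z t : dot (A *m z) t - c * dot z t
    = N z t - (c - lam ord0) * (dot (v ord0) z * dot (v ord0) t).
  rewrite (dot_mulmx_eigen A v lam)// (dot_orthonormal v z t hv) mulr_sumr -sumrB.
  rewrite /N [LHS](bigD1 ord0)//= [in RHS](bigD1 ord0)//= {1}/w eqxx.
  rewrite (eq_bigr (fun i => w i * dot (v i) z * dot (v i) t)); last first.
    by move=> i i0; rewrite /w (negbTE i0); ring.
  by ring.
have Nxx z : N z z = \sum_i w i * dot (v i) z ^+ 2.
  by apply: eq_bigr => i _; rewrite expr2 mulrA.
rewrite /quad => qx qy.
have := weighted_cauchy_schwarz w (fun i => dot (v i) x) (fun i => dot (v i) y) w0.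
rewrite -!Nxx -/(N x y) => cs.
have N0 z : 0 <= N z z by rewrite Nxx sumr_ge0// => i _; rewrite mulr_ge0 ?sqr_ge0.
have k0 : 0 <= c - lam ord0 by rewrite subr_ge0.
have := NE x x; have := NE y y; have := NE x y.
move: (N0 x) (N0 y) cs k0; set k := c - lam ord0.
set a := dot (v ord0) x in x0 *; set b := dot (v ord0) y in y0 *.
move=> Nx Ny cs k0 exy ey ex.
have hx : N x x <= k * (a * a) by lra.
have hy : N y y <= k * (b * b) by lra.
have kab : 0 <= k * (a * b) by rewrite !mulr_ge0.
suff : N x y <= k * (a * b) by lra.
apply: (le_trans (ler_norm _)).
rewrite -(ger0_norm kab) -ler_sqr ?nnegrE// !real_normK ?num_real//.
apply: (le_trans cs).
have -> : (k * (a * b)) ^+ 2 = (k * (a * a)) * (k * (b * b)) by ring.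
by apply: ler_pM.
Qed.

(** The condition cuts out a cone around $v_0$ on which the negative
    contribution of $v_0$ to the form of $A - \mu$ outweighs the positive one of
    $v_n$, the only other coordinate present. *)
Lemma quad_le_middle {R : realType} {n : nat} (A : 'M[R]_n.+1)
    (v : 'I_n.+1 -> 'cV[R]_n.+1) (lam : 'I_n.+1 -> R) (mu : R)
    (x : 'cV[R]_n.+1) :
  (0 < n)%N ->
  A = A^T -> (forall i j, dot (v i) (v j) = (i == j)%:R) ->
  (forall i, A *m v i = lam i *: v i) ->
  (forall i : 'I_n.+1, (0 < i < n)%N -> lam i = mu) ->
  lam ord0 < mu -> mu < lam ord_max ->
  Num.sqrt ((lam ord_max - mu) / (mu - lam ord0)) * `|dot (v ord_max) x|
    <= dot (v ord0) x ->
  quad A x <= mu * dot x x.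
Proof.
move=> n0 hA hv heig lam_mid lm me le_v0.
rewrite -subr_le0 /quad (dot_mulmx_eigen A v lam)// (dot_orthonormal v x x hv).
have max_neq0 : ord_max != ord0 :> 'I_n.+1 by rewrite -val_eqE /= -lt0n.
rewrite mulr_sumr -sumrB (bigD1 ord0)//= (bigD1 ord_max)//= big1 => [|i]; last first.
  case/andP=> i0 imax; rewrite lam_mid ?mulrA ?subrr//.
  by rewrite lt0n i0/= ltn_neqAle imax -ltnS ltn_ord.
set a := dot (v ord0) x in le_v0 *; set b := dot (v ord_max) x in le_v0 *.
set s := Num.sqrt _ in le_v0.
have s0 : 0 <= s by exact: sqrtr_ge0.
have s2 : (mu - lam ord0) * s ^+ 2 = lam ord_max - mu.
  rewrite sqr_sqrtr ?divr_ge0 ?subr_ge0 ?ltW// mulrC divfK//.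
  by rewrite subr_eq0 gt_eqF.
have : (s * `|b|) ^+ 2 <= a ^+ 2.
  by rewrite ler_sqr ?nnegrE ?(le_trans _ le_v0) ?mulr_ge0.
rewrite exprMn real_normK ?num_real// => h.
have l0 : 0 <= mu - lam ord0 by rewrite subr_ge0 ltW.
have {}h := ler_wpM2l l0 h; rewrite mulrA s2 !expr2 in h; lra.
Qed.

(** * Convexity and quasi-convexity *)

(** Subduality makes the end points of the segment at distance less than
    $\pi$, which excludes the antipodal case of the betweenness relation. *)
Lemma minimal_segment_between {R : realType} {n : nat} (K : set 'cV[R]_n)
    (a b : R) (g : R -> 'cV[R]_n) (t1 t t2 : R) :
  subdual K -> minimal_geodesic_segment a b g ->
  a <= t1 -> t1 <= t -> t <= t2 -> t2 <= b ->
  K (g t1) -> K (g t2) ->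
  exists c d : R, [/\ 0 <= c, 0 <= d & g t = c *: g t1 + d *: g t2].
Proof.
move=> sub geo at1 t1t tt2 t2b K1 K2.
have add := minimal_segment_additive a b g t1 t t2 geo at1 t1t tt2 t2b.
have sg u : a <= u -> u <= b -> @sphere R n (g u).
  case: geo => _ _ [G [P [_ ->]] gG] _ au ub.
  by apply: proj1 (gG (g u) _); exists u; rewrite //= in_itv/= au.
have h1 : @sphere R n (g t1) by apply: sg => //; lra.
have h : @sphere R n (g t) by apply: sg; lra.
have h2 : @sphere R n (g t2) by apply: sg => //; lra.
apply: sdist_between => //.
rewrite /sdist acos_ltpi//; have /andP[_ ->] := sphere_dot_bound _ _ h1 h2.
by rewrite andbT (lt_le_trans _ (sub _ K1 _ K2))// oppr_lt0.
Qed.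

Lemma sphere_interior_cone_convex {R : realType} {n : nat}
    (K : set 'cV[R]_n.+1) :
  is_cone K -> convex_set (K : set (convex_lmodType 'cV[R]_n.+1)) ->
  subdual K -> spherically_convex (@sphere R n.+1 `&` interior K).
Proof.
move=> coneK convK sub; split; first by move=> x [].
move=> a b g geo [_ Ka] [_ Kb] _ [t /= + <-].
rewrite in_itv/= => /andP[at_ tb].
have sgt : @sphere R n.+1 (g t).
  case: geo => _ _ [G [P [_ ->]] gG] _.
  by apply: proj1 (gG (g t) _); exists t; rewrite //= in_itv/= at_.
split; first exact: sgt.
have [c [d [c0 d0 gE]]] := minimal_segment_between K a b g a t b sub geo
  (lexx _) at_ tb (lexx _) (interior_subset Ka) (interior_subset Kb).
have scale := fun e x (e0 : 0 < e) => interior_cone_scale K e x coneK e0.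
move: c0; rewrite le_eqVlt => /predU1P[c0|c0]; last first.
  move: d0; rewrite le_eqVlt => /predU1P[d0|d0].
    by rewrite gE -d0 scale0r addr0; exact: scale.
  rewrite gE; apply: interior_cone_add => //; first exact: scale.
  by apply: coneK => //; exact: interior_subset.
move: d0; rewrite le_eqVlt => /predU1P[d0|d0]; last first.
  by rewrite gE -c0 scale0r add0r; exact: scale.
(* the zero combination is not a unit vector *)
have := sphere_dot _ sgt; rewrite gE -c0 -d0 !scale0r addr0.
by rewrite -(scale0r 0) dotZl mul0r => /eqP; rewrite eq_sym oner_eq0.
Qed.

Theorem theorem3 (R : realType) (n : nat) (hn : (3 <= n.+1)%N)
    (K : set 'cV[R]_n.+1) (hKproper : proper_cone K) (hKsubdual : subdual K)
    (A : 'M[R]_n.+1) (hA : A = A^T)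
    (v : 'I_n.+1 -> 'cV[R]_n.+1)
    (hv : forall i j : 'I_n.+1, dot (v i) (v j) = (i == j)%:R)
    (lam : 'I_n.+1 -> R)
    (heig : forall i : 'I_n.+1, A *m v i = lam i *: v i)
    (lambda mu eta : R)
    (hlambda : lam ord0 = lambda)
    (hmu : forall i : 'I_n.+1, (0 < i < n)%N -> lam i = mu)
    (heta : lam ord_max = eta)
    (hlm : lambda < mu) (hme : mu < eta)
    (hdual : dual_cone K
       (v ord0 - Num.sqrt ((eta - mu) / (mu - lambda)) *: cone_abs K (v ord_max))) :
  spherically_quasi_convex (@sphere R n.+1 `&` interior K) (quad A).
Proof.
have [coneK _ clK convK _] := hKproper.
split; first exact: sphere_interior_cone_convex.
move=> a b g geo gC t1 t2 t at1 t1t tt2 t2b.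
have C u : a <= u -> u <= b -> dot (g u) (g u) = 1 /\ K (g u).
  move=> au ub; have [|sgu Kgu] := gC (g u).
    by exists u; rewrite //= in_itv/= au.
  by split; [exact: sphere_dot | exact: interior_subset].
have [g1 K1] : dot (g t1) (g t1) = 1 /\ K (g t1) by apply: C => //; lra.
have [g2 K2] : dot (g t2) (g t2) = 1 /\ K (g t2) by apply: C => //; lra.
have [gt Kt] : dot (g t) (g t) = 1 /\ K (g t) by apply: C; lra.
have [c [d [c0 d0 gE]]] :=
  minimal_segment_between K a b g t1 t t2 hKsubdual geo at1 t1t tt2 t2b K1 K2.
rewrite -hlambda -heta in hdual hlm hme.
have v0_ge x : K x -> Num.sqrt ((lam ord_max - mu) / (mu - lam ord0))
    * `|dot (v ord_max) x| <= dot (v ord0) x.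
  move=> Kx; have := hdual x Kx; rewrite dotDl dotNl dotZl subr_ge0; apply: le_trans.
  by rewrite ler_wpM2l ?sqrtr_ge0//; exact: dot_le_cone_abs.
have v0_ge0 x : K x -> 0 <= dot (v ord0) x.
  by move=> /v0_ge; apply: le_trans; rewrite mulr_ge0 ?sqrtr_ge0.
have q_le_mu x : K x -> quad A x <= mu * dot x x.
  by move=> /v0_ge; apply: (quad_le_middle A v lam) => //; exact: ltnW hn.
have lam_cases i : i != ord0 -> mu <= lam i.
  move=> i0; have [->|imax] := eqVneq i ord_max; first exact: ltW.
  by rewrite hmu// lt0n i0/= ltn_neqAle imax -ltnS ltn_ord.
have q_ge_lam0 x : lam ord0 * dot x x <= quad A x.
  rewrite /quad (dot_mulmx_eigen A v lam)// (dot_orthonormal v x x hv) mulr_sumr.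
  apply: ler_sum => i _; rewrite -mulrA ler_wpM2r -?expr2 ?sqr_ge0//.
  have [->//|i0] := eqVneq i ord0.
  by rewrite (le_trans (ltW hlm))// lam_cases.
set m := Num.max _ _.
have m1 : quad A (g t1) <= m by rewrite le_max lexx.
have m2 : quad A (g t2) <= m by rewrite le_max lexx orbT.
have m_le_mu : m <= mu.
  by have := q_le_mu _ K1; have := q_le_mu _ K2; rewrite g1 g2 mulr1 ge_max => -> ->.
have lam_le_m : lam ord0 <= m.
  by have := q_ge_lam0 (g t1); rewrite g1 mulr1 => /le_trans; apply.
(* lam ord0 <= m <= mu leaves v ord0 as the only negative direction of A - m *)
have mixed : dot (A *m g t1) (g t2) <= m * dot (g t1) (g t2).
  apply: (quad_sublevel_mixed A v lam) => //; rewrite ?g1 ?g2 ?mulr1//.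
  - by move=> i /lam_cases; exact: le_trans.
  - exact: v0_ge0.
  - exact: v0_ge0.
have symA : dot (A *m g t2) (g t1) = dot (A *m g t1) (g t2).
  by rewrite !dotE trmx_mul -hA -mulmxA -dotE dotC dotE.
have -> : quad A (g t) = c ^+ 2 * quad A (g t1) + d ^+ 2 * quad A (g t2)
    + 2 * (c * d) * dot (A *m g t1) (g t2).
  by rewrite /quad gE mulmxDr -!scalemxAr !dot_lin symA; ring.
(* 1 = |g t|^2, expanded, so that the two sides compare term by term *)
have -> : m = c ^+ 2 * m + d ^+ 2 * m + 2 * (c * d) * (m * dot (g t1) (g t2)).
  have := gt; rewrite {1 2}gE !dot_lin g1 g2 (dotC (g t2)) => e.
  by rewrite -[LHS]mulr1 -{1}e; ring.
by do 2?apply: lerD; apply: ler_wpM2l; rewrite ?sqr_ge0 ?mulr_ge0.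
Qed.
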